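(* Let $F$ be a graph with $t:=|V(F)|\ge 3$, let $d\ge 1$ be an integer, and let $n$ be an integer with $n\ge n_0(d,t):=4dt+3d^2+5t$. If $G$ is an $n$-vertex nonhamiltonian graph with minimum degree $\delta(G)\ge d$, then $N(G,F)\le N(H_{n,d},F)$.
   Context: All graphs are finite and simple. A graph is nonhamiltonian if it has no hamiltonian cycle (a cycle through all its vertices). $\delta(G)$ is the minimum degree of $G$. For graphs $G$ and $T$, $N(G,T)$ denotes the number of labeled copies of $T$ in $G$, i.e., the number of injections $\phi:V(T)\to V(G)$ such that for each $xy\in E(T)$, $\phi(x)\phi(y)\in E(G)$. For positive integers $n,d$ with $d\le\lfloor (n-1)/2\rfloor$, $H_{n,d}$ is the $n$-vertex graph obtained from a complete graph $K_{n-d}$ with vertex set $A$ by adding $d$ pairwise nonadjacent new vertices of degree $d$, each of which is adjacent to the same $d$ vertices in $A$. *)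

(* Defs.v *)
From mathcomp Require Import all_boot.
Set Implicit Arguments.
Unset Strict Implicit.
Unset Printing Implicit Defensive.

Record sgraph := SGraph {
  vertex :> finType;
  adj : rel vertex;
  adj_sym : symmetric adj;
  adj_irrefl : irreflexive adj }.

Definition degree (G : sgraph) (x : G) : nat := #|[set y : G | adj x y]|.

(* Every degree is smaller than #|G|, so the default value #|G| does not
   affect the minimum when G has a vertex. *)
Definition min_degree (G : sgraph) : nat := \big[minn/#|G|]_(x : G) degree x.

(* A cycle has at least three vertices; [ucycle] alone also admits the empty
   sequence and, traversing one edge back and forth, two-vertex sequences. *)
Definition hamiltonian_cycle (G : sgraph) (c : seq G) : Prop :=
  [/\ 2 < size c, ucycle (@adj G) c & forall x : G, x \in c].

Definition nonhamiltonian (G : sgraph) : Prop :=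
  ~ exists c : seq G, hamiltonian_cycle c.

Definition labeled_copies (G T : sgraph) : nat :=
  #|[set phi : {ffun T -> G} | injectiveb phi &&
       [forall x : T, forall y : T, adj x y ==> adj (phi x) (phi y)]]|.

(* [inl] gives the vertices of the complete graph K_(n-d), [inr] the d added
   vertices, whose common neighbours are the first d vertices of K_(n-d). This
   is the intended n-vertex graph only when d <= (n - 1)./2. *)
Definition H_adj (n d : nat) : rel ('I_(n - d) + 'I_d) := fun u v =>
  match u, v with
  | inl i, inl j => i != j
  | inl i, inr _ => i < d
  | inr _, inl j => j < d
  | inr _, inr _ => false
  end.

Lemma H_adj_sym n d : symmetric (@H_adj n d).
Proof. by move=> [i|i] [j|j] //=; rewrite eq_sym. Qed.

Lemma H_adj_irrefl n d : irreflexive (@H_adj n d).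
Proof. by move=> [i|i] //=; rewrite eqxx. Qed.

Definition H_graph (n d : nat) : sgraph :=
  SGraph (@H_adj_sym n d) (@H_adj_irrefl n d).

Definition n0 (d t : nat) : nat := 4 * d * t + 3 * d ^ 2 + 5 * t.

(* Main.v *)
Require Import Defs.
From mathcomp Require Import all_boot.
From mathcomp Require Import zify.
Set Implicit Arguments.
Unset Strict Implicit.
Unset Printing Implicit Defensive.

(** The number of copies of [F] does not decrease when edges are added, and
by the Bondy-Chvatal argument ([add_edge_ham]) joining two nonadjacent
vertices whose degrees sum to at least [n] keeps the graph nonhamiltonian.
So one may assume that nonadjacent vertices always have degree sum below [n].
Such a graph [G] falls into one of two classes.

- For some [k] with [d < k < n / 2], at least [k] vertices have degree at
  most [k] ([many_low]).  Let [m] be the number of non-isolated vertices of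
  [F].  The placements of these vertices in the clique of [H_graph n d] alone
  give a main term [(n - d) ^_ m], up to a factor for the isolated vertices
  that is the same in both graphs.  In [G], delete [r] of the low vertices:
  the copies that avoid them contribute at most [(n - r) ^_ m], and a copy
  that puts a non-isolated vertex on one of them has only [k] choices for a
  neighbour of that vertex, so there are few of these.  Choosing [r] as
  [d + 1] or [2 d] beats the main term when [k < n / 4]; for larger [k] the
  number of edges of [G] is already so small that counting the positions of
  one edge of [F] suffices ([many_low_bound]).

- Otherwise the set [D] of vertices of degree [d] has exactly [d] elements,
  and all of them have the same neighbours [S] outside [D], with [#|S| <= d]
  ([few_low]).  The graph [G] need not be contained in [H_graph n d], because
  [D] may span edges: the clique [K_(d+1)] glued to [K_(n-d)] at one vertex is
  an example.  Enlarge [S] to a set [S'] of [d] vertices and compare [G] with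
  the copy of [H_graph n d] having [D] as independent set and [S'] as common
  neighbourhood.  A copy that is lost maps an edge of [F] into [D], hence it
  has at least two vertices [v] that are placed in [D] and have a neighbour
  placed in [D].  For a given [v] the number of such placements is compared
  with the number of gained copies that put [v] alone in [D] and some
  neighbour of [v] in [S' :\: S]: the choices for the neighbours of [v] are
  equally many, and the choices for the remaining vertices differ by a factor
  at most 2 as [n] is large.  Since every lost copy is counted twice and every
  gained copy once, no more copies are lost than gained ([copies_le_hub]). *)

(** * Finite sets *)

Lemma card_bigcup_le (I T : finType) (P : pred I) (A : I -> {set T}) :
  #|\bigcup_(i | P i) A i| <= \sum_(i | P i) #|A i|.
Proof.
elim/big_rec2: _ => [|i m B _ mB]; first by rewrite cards0.
by rewrite (leq_trans (leq_card_setU _ _)) // leq_add2l.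
Qed.

(** Used with [I] the pairs (vertex of [F], its image): it turns the sizes of
families of injections into the number of families each injection meets. *)
Lemma double_count (I T : finType) (E : I -> {set T}) :
  \sum_i #|E i| = \sum_a #|[set i | a \in E i]|.
Proof.
under eq_bigr => i _ do rewrite -sum1_card big_mkcond.
rewrite exchange_big; apply: eq_bigr => a _.
by rewrite -big_mkcond /= sum1dep_card.
Qed.

Lemma exists_intermediate_set (T : finType) (A B : {set T}) m :
  A \subset B -> #|A| <= m -> m <= #|B| ->
  exists C : {set T}, [/\ A \subset C, C \subset B & #|C| = m].
Proof.
move=> AB; elim: m => [|m IHm] Am mB.
  by exists A; split=> //; apply/eqP; rewrite -leqn0.
case: (ltngtP #|A| m.+1) Am => // [Am | Am] _; last by exists A.
have [C [AC CB Cm]] := IHm Am (ltnW mB).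
have /properP[_ [x xB xC]] : C \proper B by rewrite properEcard CB Cm.
exists (x |: C); split; last by rewrite cardsU1 xC Cm.
  exact: subset_trans AC (subsetUr _ _).
by rewrite subUset sub1set xB.
Qed.

(** * Injections with prescribed values *)

Section Extensions.
Variables T V : finType.

(** [X] is the part already placed (by [g]), [N] the part confined to [U], and
everything else goes to [W].  Every class of injections counted below has
this form: [X] is empty or a single vertex, and [N] is empty, a neighbour of
that vertex, its whole neighbourhood, or the non-isolated vertices. *)
Definition inj_ext (X : {set T}) (g : T -> V) (N : {set T}) (U W : {set V}) :=
  [set phi : {ffun T -> V} | injectiveb phi &
    [forall y, if y \in X then phi y == g y
               else phi y \in (if y \in N then U else W)]].

Lemma inj_extP (X : {set T}) g (N : {set T}) (U W : {set V}) (phi : {ffun T -> V}) :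
  reflect (injective phi /\ forall y, if y \in X then phi y = g y
                           else phi y \in (if y \in N then U else W))
          (phi \in inj_ext X g N U W).
Proof.
rewrite inE; apply: (iffP andP) => -[/injectiveP phi_inj phiP].
  by split=> // y; move/forallP: phiP => /(_ y); case: ifP => // _ /eqP.
split=> //; apply/forallP=> y; have := phiP y.
by case: ifP => // _ ->.
Qed.

Definition upd (g : T -> V) y w : T -> V := [eta g with y |-> w].

(** Placing one more vertex [y] at [w] leaves a problem of the same kind, with
[w] no longer available; this drives the inductions below. *)
Lemma inj_ext_step (X : {set T}) g (N : {set T}) (U W : {set V}) y w :
  y \notin X -> w \in (if y \in N then U else W) ->
  [set phi in inj_ext X g N U W | phi y == w]
    = inj_ext (y |: X) (upd g y w) (N :\ y) (U :\ w) (W :\ w).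
Proof.
move=> yX wUW; apply/setP=> phi; rewrite inE; apply/andP/inj_extP.
  case=> /inj_extP[phi_inj phiP] /eqP phiy; split=> // z.
  rewrite !inE; case: (eqVneq z y) => [-> | zy] /=; first by rewrite /upd /= eqxx.
  have phizw : phi z != w by rewrite -phiy (inj_eq phi_inj).
  by have := phiP z; rewrite /upd /= (negPf zy); case: ifP => // _; case: ifP; rewrite !inE phizw.
case=> phi_inj phiP.
have phiy : phi y = w by have := phiP y; rewrite /upd !inE eqxx /= eqxx.
split; last exact/eqP.
apply/inj_extP; split=> // z; have := phiP z.
rewrite !inE; case: (eqVneq z y) => [-> _ | zy] /=.
  by rewrite (negPf yX) phiy.
by rewrite /upd /= (negPf zy); case: ifP => // _; case: ifP; rewrite !inE => _ /andP[].
Qed.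

Lemma card_inj_ext_step (X : {set T}) g (N : {set T}) (U W : {set V}) y c :
  y \notin X ->
  (forall w, w \in (if y \in N then U else W) ->
     #|inj_ext (y |: X) (upd g y w) (N :\ y) (U :\ w) (W :\ w)| = c) ->
  #|inj_ext X g N U W| = #|if y \in N then U else W| * c.
Proof.
move=> yX cP; rewrite -sum1_card.
rewrite (partition_big (fun phi : {ffun T -> V} => phi y)
           (mem (if y \in N then U else W))) /=; last first.
  by move=> phi /inj_extP[_ /(_ y)]; rewrite (negPf yX).
rewrite -sum_nat_const; apply: eq_bigr => w wUW.
by rewrite -(cP w wUW) -inj_ext_step // sum1dep_card; apply: eq_card => phi; rewrite !inE.
Qed.

Lemma upd_inj (X : {set T}) (g : T -> V) y w (W : {set V}) :
  {in X &, injective g} -> (forall x, x \in X -> g x \notin W) -> y \notin X -> w \in W ->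
  {in y |: X &, injective (upd g y w)} /\
  (forall x, x \in y |: X -> upd g y w x \notin W :\ w).
Proof.
move=> g_inj gW yX wW; rewrite /upd; split=> [a b|a]; rewrite !inE /=.
  case: (eqVneq a y) => [-> | ay]; case: (eqVneq b y) => [-> | b_y] //= aX bX.
  - by move=> def_w; have := gW _ bX; rewrite -def_w wW.
  - by move=> def_w; have := gW _ aX; rewrite def_w wW.
  - exact: g_inj.
case: (eqVneq a y) => [_ _ | _ /= aX]; first by rewrite eqxx.
by rewrite (negPf (gW _ aX)) andbF.
Qed.

Lemma card_inj_ext0 (X : {set T}) g (U W : {set V}) :
  {in X &, injective g} -> (forall x, x \in X -> g x \notin W) ->
  #|inj_ext X g set0 U W| = #|W| ^_ (#|T| - #|X|).
Proof.
have [m] := ubnP (#|T| - #|X|); elim: m => // m IHm in X g U W * => Xm g_inj gW.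
have [XT | [y yX]] : X = setT \/ exists y, y \notin X.
  case: (pickP [pred y | y \notin X]) => [y yX | X_T]; first by right; exists y.
  by left; apply/setP=> y; rewrite inE; apply/negbFE/X_T.
  rewrite XT cardsT subnn ffactn0; apply/eqP/cards1P.
  exists (finfun g); apply/setP=> phi; rewrite inE; apply/inj_extP/eqP.
    by case=> _ phiP; apply/ffunP=> y; rewrite ffunE; have := phiP y; rewrite inE.
  move=> ->; split=> [a b | y]; last by rewrite inE ffunE.
  by rewrite !ffunE; apply: g_inj; rewrite XT inE.
have ltXT : #|X| < #|T| by rewrite -cardsT proper_card // properE subsetT; apply/subsetPn; exists y.
rewrite (@card_inj_ext_step _ _ _ _ _ y (#|W|.-1 ^_ (#|T| - #|X|.+1))) // ?inE.
  by rewrite -ffactnS; congr (_ ^_ _); lia.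
move=> w wW; rewrite set0D; have [gi' gW'] := upd_inj g_inj gW yX wW.
have Xy : #|y |: X| = #|X|.+1 by rewrite cardsU1 yX.
have Ww : #|W :\ w| = #|W|.-1 by rewrite (cardsD1 w W) wW.
by rewrite IHm ?Xy ?Ww //; lia.
Qed.

(** As [U \subset W], placing the vertices of [N] first leaves
[#|W| - #|N|] places for the others, wherever in [U] those of [N] went. *)
Lemma card_inj_ext (X : {set T}) g (N : {set T}) (U W : {set V}) :
  {in X &, injective g} -> (forall x, x \in X -> g x \notin W) ->
  [disjoint N & X] -> U \subset W ->
  #|inj_ext X g N U W| =
    #|U| ^_ #|N| * (#|W| - #|N|) ^_ (#|T| - #|X| - #|N|).
Proof.
have [m] := ubnP #|N|; elim: m => // m IHm in X g N U W * => Nm g_inj gW NX UW.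
have [-> | [y yN]] := set_0Vmem N.
  by rewrite card_inj_ext0 // cards0 !subn0 ffactn0 mul1n.
have yX : y \notin X by rewrite (disjointFr NX).
have NE : #|N| = #|N :\ y|.+1 by rewrite (cardsD1 y) yN.
rewrite (@card_inj_ext_step _ _ _ _ _ y
  (#|U|.-1 ^_ #|N :\ y| * (#|W| - #|N|) ^_ (#|T| - #|X| - #|N|))) // yN.
  by rewrite mulnA -ffactnS -NE.
move=> w wU; have wW := subsetP UW _ wU.
have [gi' gW'] := upd_inj g_inj gW yX wW.
have Xy : #|y |: X| = #|X|.+1 by rewrite cardsU1 yX.
have Ww : #|W| = #|W :\ w|.+1 by rewrite (cardsD1 w W) wW.
have Uw : #|U :\ w| = #|U|.-1 by rewrite (cardsD1 w U) wU.
rewrite IHm //.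
- by rewrite Xy Uw Ww NE; congr (_ * _ ^_ _); lia.
- by rewrite -ltnS -NE.
- rewrite -setI_eq0; apply/eqP/setP=> z; rewrite !inE.
  case: (eqVneq z y) => //= _; apply/negbTE/negP=> /andP[zN].
  by rewrite (disjointFr NX).
- exact: setSD.
Qed.

End Extensions.

Lemma inj_ext_subset (T V : finType) (X N : {set T}) g (U U' W : {set V}) :
  U \subset U' -> inj_ext X g N U W \subset inj_ext X g N U' W.
Proof.
move/subsetP=> UU'; apply/subsetP=> phi /inj_extP[phi_inj phiP].
apply/inj_extP; split=> // y; have := phiP y.
by case: ifP => // _; case: ifP => // _ /UU'.
Qed.

(** * Falling factorials *)

Lemma ffactS_split m p : m.+1 ^_ p = m ^_ p + p * m ^_ p.-1.
Proof.
case: p => [|p]; first by rewrite !ffactn0.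
rewrite ffactSS ffactnSr /= [m ^_ p * _]mulnC -mulnDl.
case: (leqP p m) => pm; last by rewrite ffact_small ?muln0.
by congr (_ * _); lia.
Qed.

Lemma leq_ffact2l p m n : m <= n -> m ^_ p <= n ^_ p.
Proof.
elim: p m n => [|p IHp] [|m] [|n] // mn; rewrite !ffactSS.
by rewrite leq_mul // IHp.
Qed.

(** This bound and [ffact_le_sub] enclose [m ^_ p - (m - j) ^_ p] by keeping
the smallest, respectively the largest, of the [j] terms obtained from
[ffactS_split]. *)
Lemma ffact_sub_le m j p : j <= m -> (m - j) ^_ p + j * p * (m - j) ^_ p.-1 <= m ^_ p.
Proof.
move=> jm; rewrite -{3}(subnK jm); move: (m - j) => a {m jm}.
elim: j => [|j IHj]; first by rewrite !mul0n !addn0.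
rewrite addnS ffactS_split.
have : p * a ^_ p.-1 <= p * (a + j) ^_ p.-1.
  by rewrite leq_mul2l leq_ffact2l ?orbT // leq_addr.
nia.
Qed.

Lemma ffact_le_sub m j p : j <= m -> m ^_ p <= (m - j) ^_ p + j * p * m.-1 ^_ p.-1.
Proof.
move=> jm; rewrite -{1 3}(subnK jm); move: (m - j) => a {m jm}.
elim: j => [|j IHj]; first by rewrite !mul0n !addn0.
rewrite addnS ffactS_split /=.
have : p * (a + j).-1 ^_ p.-1 <= p * (a + j) ^_ p.-1.
  by rewrite leq_mul2l leq_ffact2l ?orbT // leq_pred.
nia.
Qed.

Lemma ffact_add m p q : p <= m -> m ^_ (p + q) = m ^_ p * (m - p) ^_ q.
Proof.
elim: p m => [|p IHp] m pm; first by rewrite ffactn0 mul1n subn0.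
case: m pm => // m pm; rewrite addSn !ffactSS IHp // mulnA; congr (_ * _ ^_ _).
Qed.

(** By [ffact_le_sub], replacing [n - 1] available places by [n - d] costs at
most the fraction [(d - 1) (t - 1 - a) / (n - 1 - a)], which is at most 1/2
here. *)
Lemma ffact_le_double n d t a : 0 < d -> 2 * (d * t) <= n - t -> a < t ->
  (n.-1 - a) ^_ (t.-1 - a) <= 2 * (n - d - a) ^_ (t.-1 - a).
Proof.
move=> d_gt0 n_large at_lt.
case: (posnP (t.-1 - a)) => [-> | p_gt0]; first by rewrite !ffactn0.
have jm : d.-1 <= n.-1 - a by nia.
have := @ffact_le_sub (n.-1 - a) d.-1 (t.-1 - a) jm.
have -> : n.-1 - a - d.-1 = n - d - a by lia.
have : 2 * (d.-1 * (t.-1 - a)) <= n.-1 - a by nia.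
have : t.-1 - a <= t by lia.
case: (t.-1 - a) p_gt0 => // p _ _ /=.
rewrite ffactnS.
move: (n.-1 - a) ((n - d - a) ^_ p.+1) => m L.
move: (m.-1 ^_ p) (d.-1 * p.+1) => M c cm.
have : 2 * c * M <= m * M by rewrite leq_mul2r cm orbT.
lia.
Qed.

(** * Labeled copies *)

Section Copies.
Variables (G F : sgraph).

Definition copies : {set {ffun F -> G}} :=
  [set phi : {ffun F -> G} | injectiveb phi &&
       [forall x : F, forall y : F, adj x y ==> adj (phi x) (phi y)]].

Lemma labeled_copiesE : labeled_copies G F = #|copies|.
Proof. by []. Qed.

Lemma copiesP (phi : {ffun F -> G}) :
  reflect (injective phi /\ forall x y, adj x y -> adj (phi x) (phi y)) (phi \in copies).
Proof.
rewrite inE; apply: (iffP andP) => -[/injectiveP phi_inj phiP].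
  split=> // x y; move/forallP: phiP => /(_ x)/forallP/(_ y)/implyP; exact.
split=> //; apply/forallP=> x; apply/forallP=> y; apply/implyP; exact: phiP.
Qed.

End Copies.

Lemma labeled_copies_hom (G H F : sgraph) (g : G -> H) :
  injective g -> (forall u v, adj u v -> adj (g u) (g v)) ->
  labeled_copies G F <= labeled_copies H F.
Proof.
move=> g_inj g_hom; pose comp (phi : {ffun F -> G}) := [ffun x => g (phi x)].
have comp_inj : injective comp.
  move=> phi psi /ffunP eq_comp; apply/ffunP=> x; apply: g_inj.
  by have := eq_comp x; rewrite !ffunE.
rewrite !labeled_copiesE -(card_imset _ comp_inj).
apply/subset_leq_card/subsetP=> _ /imsetP[phi /copiesP[phi_inj phi_hom] ->].
apply/copiesP; split=> [x y | x y xy]; rewrite !ffunE.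
  by move/g_inj/phi_inj.
exact/g_hom/phi_hom.
Qed.

(** * Bondy-Chvatal closure *)

Section AddEdge.
Variables (G : sgraph) (x y : G).

(** The conjunct [x != y] keeps the relation irreflexive for all [x] and [y]. *)
Definition add_edge_adj : rel G := fun u v =>
  adj u v || ((x != y) && (((u == x) && (v == y)) || ((u == y) && (v == x)))).

Lemma add_edge_sym : symmetric add_edge_adj.
Proof.
move=> u v; rewrite /add_edge_adj adj_sym orbC [in RHS]orbC; congr (_ && _ || _).
by rewrite orbC; congr (_ || _); rewrite andbC.
Qed.

Lemma add_edge_irrefl : irreflexive add_edge_adj.
Proof.
move=> u; rewrite /add_edge_adj adj_irrefl /=.
by case: (eqVneq u x) => [-> | _]; case: (eqVneq x y); rewrite //= ?andbF.
Qed.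

Definition add_edge : sgraph := SGraph add_edge_sym add_edge_irrefl.

End AddEdge.

(** The [count]s are those of the positions [i] at which [a] holds of the
[i]-th element of [p], respectively [b] holds of the element before it in
[u :: p].  They are too many to be disjoint. *)
Lemma crossing (V : eqType) (a b : pred V) u p :
  size p < count a p + count b (belast u p) ->
  exists p1 z p2, [/\ p = p1 ++ z :: p2, a z & b (last u p1)].
Proof.
elim: p u => [|z p IHp] u //=; case az: (a z); case bu: (b u) => /= lt_p; first by exists [::], z, p.
all: have [|p1 [z' [p2 [-> az' bp1]]]] := IHp z; first by lia.
all: by exists (z :: p1), z', p2.
Qed.

Section Ore.
Variable G : sgraph.
Implicit Types (x y : G) (p c : seq G).

Lemma degree_count x c : uniq c -> (forall z, adj x z -> z \in c) -> count (adj x) c = degree x.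
Proof.
move=> c_uniq c_all; rewrite -size_filter /degree cardE; apply/perm_size/uniq_perm.
- exact: filter_uniq.
- exact: enum_uniq.
by move=> z; rewrite mem_filter mem_enum inE; case xz: (adj x z) => //=; rewrite c_all.
Qed.

(** Ore's rotation: by [crossing], some edge [w z] of the path has [x]
adjacent to [z] and [y] adjacent to [w]; dropping it and adding [x z] and
[w y] closes the path into a cycle. *)
Lemma ham_of_path x y p :
  path (@adj G) x p -> last x p = y -> uniq (x :: p) -> (forall z, z \in x :: p) ->
  2 < #|G| -> #|G| <= degree x + degree y ->
  exists c, hamiltonian_cycle c.
Proof.
move=> xp lastp p_uniq p_all G_gt2 deg_xy.
have sizep : #|G| = (size p).+1.
  by rewrite -[RHS]/(size (x :: p)) -(card_uniqP p_uniq); apply/esym/eq_card=> z; rewrite p_all.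
have degx : count (adj x) p = degree x.
  apply: degree_count => [|z xz]; first by case/andP: p_uniq.
  by have := p_all z; rewrite inE => /orP[/eqP zx|//]; rewrite zx adj_irrefl in xz.
have degy : count (adj y) (belast x p) = degree y.
  move: p_uniq; rewrite lastI rcons_uniq => /andP[_ b_uniq].
  apply: degree_count => // z yz.
  have := p_all z; rewrite lastI mem_rcons inE lastp => /orP[/eqP zx|//].
  by rewrite zx adj_irrefl in yz.
have [|p1 [z [p2 [def_p xz yp1]]]] := @crossing _ (adj x) (adj y) x p.
  by rewrite degx degy -sizep.
exists (x :: p1 ++ rev (z :: p2)).
have perm_p : perm_eq (x :: p1 ++ rev (z :: p2)) (x :: p).
  by rewrite def_p perm_cons perm_cat2l perm_rev.
split; last by move=> u; rewrite (perm_mem perm_p).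
  by rewrite (perm_size perm_p) /=; lia.
rewrite /ucycle (perm_uniq perm_p) p_uniq andbT.
move: xp lastp; rewrite def_p cat_path last_cat /= => /and3P[xp1 _ zp2] lastp.
rewrite rcons_cat cat_path xp1 /= lastI rev_rcons lastp /= adj_sym yp1 /=.
rewrite rcons_path -lastp rev_path.
rewrite (eq_path (e' := @adj G)); last by move=> ? ?; rewrite adj_sym.
rewrite zp2 /=.
have -> : last (last z p2) (rev (belast z p2)) = z.
  by case: (p2) => //= w q; rewrite rev_cons last_rcons.
by rewrite adj_sym.
Qed.

Lemma path_add_edge x y p u : x \notin p -> u != x ->
  path (@add_edge_adj G x y) u p -> path (@adj G) u p.
Proof.
elim: p u => //= z p IHp u; rewrite !inE !negb_or => /andP[xz xp] ux /andP[uz zp].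
rewrite IHp ?(eq_sym z) // andbT; move: uz; rewrite /add_edge_adj.
by rewrite (negPf ux) [z == x]eq_sym (negPf xz) !andbF orbF.
Qed.

(** A cycle of the enlarged graph that is not a cycle of [G] uses the new edge,
and without it becomes a hamiltonian path of [G] from [x] to [y]. *)
Lemma add_edge_ham x y (c : seq (add_edge x y)) :
  hamiltonian_cycle c -> #|G| <= degree x + degree y ->
  exists c' : seq G, hamiltonian_cycle c'.
Proof.
case=> c_gt2 /andP[c_cycle c_uniq] c_all deg_xy.
have G_gt2 : 2 < #|G| by rewrite (leq_trans c_gt2) // -(card_uniqP c_uniq) max_card.
have [i p def_c] := rot_to (c_all x).
have {c_cycle} : cycle (@add_edge_adj G x y) (x :: p) by rewrite -def_c rot_cycle.
have xp_uniq : uniq ((x : G) :: p) by rewrite -def_c rot_uniq.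
have xp_all (z : G) : z \in (x : G) :: p by rewrite -def_c mem_rot; apply: c_all.
have {c_gt2} p_gt1 : 1 < size p by rewrite -ltnS -[(size p).+1]/(size (x :: p)) -def_c size_rot.
move: p {def_c c_all c_uniq} xp_uniq xp_all p_gt1.
have adj_of z : z != y -> add_edge_adj x y x z -> adj x z.
  by rewrite /add_edge_adj => /negPf->; rewrite andbF /=; case: (x == y); rewrite orbF.
(* Starting at [x], the new edge can only be the first or the last one of the
   cycle; reversing the cycle if necessary, it is not the first. *)
have to_path p : uniq (x :: p) -> (forall z, z \in x :: p) -> 1 < size p -> head y p != y ->
  cycle (@add_edge_adj G x y) (x :: p) -> exists c' : seq G, hamiltonian_cycle c'.
  case: p => //= z p /andP[] xzp zp_uniq p_all p_gt0 zy /andP[xz zpx].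
  move: xzp; rewrite inE negb_or => /andP[xz' xp].
  move: zpx; rewrite rcons_path => /andP[zp lastx].
  have xzp' : path (@adj G) x (z :: p) by rewrite /= adj_of // (path_add_edge xp _ zp) // eq_sym.
  have uniq_xzp : uniq (x :: z :: p) by rewrite /= inE negb_or xz' xp.
  case: (eqVneq (last z p) y) => [lasty | lastNy].
    exact: ham_of_path xzp' lasty uniq_xzp p_all G_gt2 deg_xy.
  exists (x :: z :: p); split=> //; rewrite /ucycle uniq_xzp andbT.
  rewrite /cycle -cats1 cat_path xzp' /= andbT adj_sym adj_of //.
  by have := add_edge_sym x y x (last z p); rewrite lastx.
move=> p p_uniq p_all p_gt1 p_cyc.
case: (eqVneq (head y p) y) => [heady | Nheady]; last exact: to_path Nheady p_cyc.
apply: (to_path (rev p)); rewrite ?size_rev //.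
- by rewrite /= rev_uniq mem_rev.
- by move=> z; rewrite inE mem_rev -in_cons.
- case: p p_uniq p_gt1 heady {p_all p_cyc} => // z [//|w p] /= p_uniq _ zy.
  have /andP[_ /andP[zwp _]] := p_uniq.
  rewrite [z :: _]lastI rev_rcons /= -zy.
  by apply: contraNneq zwp => <-; apply: mem_last.
rewrite -[x :: _]rotr1_rcons rotr_cycle -rev_cons rev_cycle.
by rewrite (eq_cycle (e' := @add_edge_adj G x y)) // => u v; rewrite add_edge_sym.
Qed.
End Ore.

(** * Degrees in Ore-closed nonhamiltonian graphs *)

Lemma min_degree_le (G : sgraph) (x : G) : min_degree G <= degree x.
Proof.
rewrite /min_degree; have := mem_index_enum x.
elim: (index_enum G) => // y s IHs; rewrite inE big_cons geq_min => /orP[/eqP <-|/IHs->].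
  by rewrite leqnn.
by rewrite orbT.
Qed.

(** No further edge can be added by [add_edge_ham]. *)
Definition ore_closed (G : sgraph) :=
  forall x y : G, x != y -> ~~ adj x y -> degree x + degree y < #|G|.

Definition low (G : sgraph) (k : nat) : {set G} := [set v | degree v <= k].

Lemma complete_ham (G : sgraph) :
  2 < #|G| -> (forall x y : G, x != y -> adj x y) -> exists c : seq G, hamiltonian_cycle c.
Proof.
move=> G_gt2 G_complete; exists (enum G); split=> [||x]; rewrite ?mem_enum -?cardE //.
rewrite /ucycle enum_uniq andbT.
have upath (x : G) p : uniq (x :: p) -> path (@adj G) x p.
  elim: p x => //= y p IHp x; rewrite inE negb_or => /andP[/andP[xy _] yp].
  by rewrite G_complete // IHp.
move: (enum_uniq G) G_gt2; rewrite cardE; case: (enum G) => [|x [|y p]] // xyp _.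
rewrite /cycle rcons_path upath //= G_complete //.
by case/andP: xyp => xyp _; apply: contraNneq xyp => <-; apply: mem_last.
Qed.

Section Structure.
Variable G : sgraph.
Implicit Types x y u v : G.

Lemma card_setC n (A : {set G}) : #|G| = n -> #|A| + #|~: A| = n.
Proof. by move=> <-; rewrite cardsC. Qed.

Lemma card_nonadj v : #|[set z | (z != v) && ~~ adj z v]| + degree v + 1 = #|G|.
Proof.
rewrite -(cardsC [set z | (z != v) && ~~ adj z v]) -addnA; congr (_ + _).
rewrite [RHS](cardsD1 v) inE in_set eqxx /= addnC; congr (_ + _).
apply: eq_card=> z; rewrite !inE adj_sym.
by case: (eqVneq z v) => [->|]; rewrite ?adj_irrefl //= negbK.
Qed.

(** Chvatal's argument.  Among the nonadjacent pairs outside the vertices of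
degree at most [d], take one, [(u, v)], with [degree u <= degree v], that
maximises the degree sum, and let [k] be [degree u].  By maximality every
non-neighbour of [v] has degree at most [k], and since the degree sum is below
[#|G|] there are at least [k] of them. *)
Lemma many_low d u v :
  ore_closed G -> u != v -> ~~ adj u v -> d < degree u -> d < degree v ->
  exists k, [/\ d < k, k.*2 < #|G| & k <= #|low G k|].
Proof.
move=> G_ore uv Nuv du dv.
pose P (p : G * G) := [&& p.1 != p.2, ~~ adj p.1 p.2, d < degree p.1, d < degree p.2
                        & degree p.1 <= degree p.2].
have [p0 Pp0] : exists p, P p.
  case/orP: (leq_total (degree u) (degree v)) => uv_deg.
    by exists (u, v); rewrite /P /= uv Nuv du dv.
  by exists (v, u); rewrite /P /= eq_sym uv adj_sym Nuv du dv.
have := @arg_maxnP _ p0 P (fun p => degree p.1 + degree p.2) Pp0.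
case=> -[{}u {}v] /and5P[/= {}uv {}Nuv {}du {}dv uv_deg] p_max {p0 Pp0}.
have uv_lt := G_ore _ _ uv Nuv.
exists (degree u); split=> //; first by apply: leq_ltn_trans uv_lt; lia.
have : #|[set z | (z != v) && ~~ adj z v]| <= #|low G (degree u)|.
  apply/subset_leq_card/subsetP=> z; rewrite !inE => /andP[zv Nzv].
  case: (leqP (degree z) (degree u)) => // uz.
  case/orP: (leq_total (degree z) (degree v)) => zv_deg.
    have /p_max /= : P (z, v) by rewrite /P /= zv Nzv dv zv_deg (ltn_trans du uz).
    by lia.
  have /p_max /= : P (v, z) by rewrite /P /= eq_sym zv adj_sym Nzv dv zv_deg (ltn_trans du uz).
  by lia.
by have := card_nonadj v; lia.
Qed.

(** Let [D] be the low vertices.  A vertex outside [D] with a neighbour in [D]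
has degree at least [n - d], so every vertex of [D], having degree [d], must
be adjacent to it.  Hence the vertices of [D] share their neighbours [S]
outside [D].  A vertex outside both [D] and [S] has degree [n - 1 - #|D|];
being nonadjacent to vertices of degree [d], it forces [d <= #|D|]. *)
Lemma few_low n d : #|G| = n ->
  ore_closed G -> nonhamiltonian G -> 2 < n -> d.*2 < n -> (forall x, d <= degree x) ->
  #|low G d| <= d -> (forall u v, u \notin low G d -> v \notin low G d -> u != v -> adj u v) ->
  #|low G d| = d /\
  exists S : {set G}, [/\ S \subset ~: low G d, #|S| <= d &
     forall x u, x \in low G d -> u \notin low G d -> adj x u = (u \in S)].
Proof.
move=> Gn G_ore G_nonham G_gt2 G_gt_d deg_d; set D := low G d => D_le D_clique.
have degD x : x \in D -> degree x = d.
  by rewrite inE => degx; apply/eqP; rewrite eqn_leq degx deg_d.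
move: D degD D_le D_clique => D degD D_le D_clique.
pose S := [set u in ~: D | [exists x in D, adj x u]].
have SD : S \subset ~: D by apply/subsetP=> u; rewrite inE => /andP[].
have adjS x u : x \in D -> u \notin D -> adj x u = (u \in S).
  move=> xD uD; rewrite !inE uD /=; apply/idP/exists_inP=> [xu|[y yD yu]]; first by exists x.
  apply: contraT => Nxu; have xu : x != u by apply: contraNneq uD => <-.
  have := G_ore _ _ xu Nxu; rewrite Gn degD //.
  have : #|y |: (~: D :\ u)| <= degree u.
    apply/subset_leq_card/subsetP=> z; rewrite !inE => /orP[/eqP->|/andP[zu zD]]; first by rewrite adj_sym.
    by apply: D_clique; rewrite // ?inE // eq_sym.
  rewrite cardsU1 !inE yD andbF /=.
  have := cardsD1 u (~: D); rewrite inE uD /=; have := card_setC D Gn; lia.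
clearbody S; have [D0 | [x xD]] := set_0Vmem D.
  case: G_nonham; apply: complete_ham; rewrite ?Gn // => x y; by apply: D_clique; rewrite D0 inE.
have S_le : #|S| <= d.
  rewrite -(degD x xD); apply/subset_leq_card/subsetP=> u uS; rewrite inE adjS //.
  by have := subsetP SD u uS; rewrite inE.
split; last by exists S.
have [w wD wS] : exists2 w, w \notin D & w \notin S.
  have : 0 < #|~: D :\: S| by have := card_setC D Gn; rewrite cardsD (setIidPr SD); lia.
  by case/card_gt0P=> w; rewrite !inE => /andP[wS wD]; exists w.
have Nxw : ~~ adj x w by rewrite adjS.
have xw : x != w by apply: contraNneq wD => <-.
have := G_ore _ _ xw Nxw; rewrite Gn degD //.
have : #|~: D :\ w| <= degree w.
  apply/subset_leq_card/subsetP=> z; rewrite !inE => /andP[zw zD].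
  by apply: D_clique; rewrite // ?inE // eq_sym.
have := cardsD1 w (~: D); rewrite inE wD /=; have := card_setC D Gn; lia.
Qed.

End Structure.

(** * Many vertices of low degree *)

(** The left-hand side bounds the copies in [G] after deletion of [r] vertices
of degree at most [k] ([copies_le_delete]); [s + 2] stands for the number of
non-isolated vertices of [F], and the common factor that counts the placements
of the isolated ones is removed. *)
Lemma delete_arith n d k r s : d < r -> r <= n ->
  r * k <= (r - d) * (n.-1 - r.-1 * s.+1) ->
  (n - r) ^_ s.+2 + r * s.+2 * k * (n - 2) ^_ s <= (n - d) ^_ s.+2.
Proof.
move=> dr rn rk.
have jle : r - d <= n - d by lia.
have := @ffact_sub_le (n - d) (r - d) s.+2 jle.
have -> : n - d - (r - d) = n - r by lia.
apply: leq_trans; rewrite leq_add2l /=.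
have r1n : r.-1 <= n.-1 by lia.
have := @ffact_le_sub n.-1 r.-1 s.+1 r1n.
have -> : n.-1 - r.-1 = n - r by lia.
have n2 : n.-1.-1 = n - 2 by lia.
rewrite ffactnS n2 /=; move: ((n - 2) ^_ s) ((n - r) ^_ s.+1) => M L ML.
have : (n.-1 - r.-1 * s.+1) * M <= L by rewrite mulnBl leq_subLR addnC.
move: (n.-1 - _) rk => z rk zM.
apply: (@leq_trans ((r - d) * s.+2 * (z * M))); last by rewrite leq_mul2l zM orbT.
rewrite (mulnC r) (mulnC (r - d)) -!mulnA leq_mul2l /= !mulnA leq_mul2r rk orbT.
by [].
Qed.

(** Divided by [(n - 2) ^_ s], the right-hand side is at least
[(n - 1) (n - d (s + 2))], that is at least [3 n (n - 1) / 4].  The quadratic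
in [k] on the left is convex and stays below this for [n / 4 <= k < n / 2],
with near equality at the right end: this is where the term [4 * d * t] in the
bound on [n] comes from. *)
Lemma edge_arith n d k s :
  4 * d * s.+2 + 3 * d ^ 2 + 5 * s.+2 <= n -> n <= 4 * k -> k.*2 < n ->
  (2 * k ^ 2 + (n - k) * (n - k).-1) * (n - 2) ^_ s <= (n - d) ^_ s.+2.
Proof.
move=> n_large k_large kn.
have dn : d <= n by lia.
have := @ffact_le_sub n d s.+2 dn.
have n2 : n.-1.-1 = n - 2 by lia.
rewrite /= !(ffactnS _ s.+1) !(ffactnS _ s) n2.
rewrite -!(ffactnS _ s) -!(ffactnS _ s.+1).
move: ((n - 2) ^_ s) ((n - d) ^_ s.+2) => M L ML.
have : (n - d * s.+2) * n.-1 * M <= L.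
  by rewrite -mulnA mulnBl leq_subLR addnC.
apply: leq_trans; rewrite leq_mul2r; apply/orP; right.
(* [c + 1] is twice the distance from [k] to the critical value [n / 2]. *)
have [c defc] : exists c, n = k.*2 + c.+1 by exists (n - k.*2).-1; lia.
have : 3 * n + 5 <= 4 * (n - d * s.+2) by lia.
move: (n - d * s.+2) => z zn.
subst n.
have -> : (k.*2 + c.+1).-1 = k.*2 + c by lia.
have -> : k.*2 + c.+1 - k = k + c.+1 by lia.
have -> : (k + c.+1).-1 = k + c by lia.
suff : 4 * (2 * k ^ 2 + (k + c.+1) * (k + c)) <= (3 * (k.*2 + c.+1) + 5) * (k.*2 + c) by nia.
have : c.+1 <= k.*2 by lia.
move=> {zn ML z L M n2 n_large k_large kn dn}; rewrite -mul2n; nia.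
Qed.

Definition non_isolated (F : sgraph) : {set F} := [set x | [exists y, adj x y]].

Section Bounds.
Variables (F : sgraph) (t : nat).
Hypothesis Ft : #|F| = t.
Let N := non_isolated F.

(** No vertex is placed in advance, so any map [g] will do; one exists because
[V] is nonempty. *)
Lemma card_inj_into (V : finType) n (U : {set V}) : #|V| = n -> 0 < n ->
  exists g, #|inj_ext set0 g N U [set: V]| = #|U| ^_ #|N| * (n - #|N|) ^_ (t - #|N|).
Proof.
move=> Vn /[dup] n_gt0; rewrite -{1}Vn => /card_gt0P[v0 _].
exists (fun _ => v0); rewrite card_inj_ext ?subsetT //.
- by rewrite cards0 subn0 cardsT Vn Ft.
- by move=> x y; rewrite inE.
- by move=> x; rewrite inE.
- by rewrite -setI_eq0 setI0.
Qed.

(** Only the copies whose non-isolated vertices lie in the clique are counted. *)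
Lemma H_copies_ge n d : 0 < n -> d <= n ->
  (n - d) ^_ #|N| * (n - #|N|) ^_ (t - #|N|) <= labeled_copies (H_graph n d) F.
Proof.
move=> n_gt0 dn.
have Hn : #|H_graph n d| = n by rewrite card_sum !card_ord; lia.
pose U : {set H_graph n d} := [set inl i | i : 'I_(n - d)].
have Ucard : #|U| = n - d by rewrite card_imset ?card_ord // => i j [].
have [g] := card_inj_into U Hn n_gt0; rewrite Ucard => <-.
apply/subset_leq_card/subsetP=> phi /inj_extP[phi_inj phiP].
apply/copiesP; split=> // x y xy.
have phiN z : z \in N -> exists i, phi z = inl i.
  by move=> zN; have := phiP z; rewrite inE zN => /imsetP[i _ ->]; exists i.
have [|i def_i] := phiN x; first by rewrite inE; apply/existsP; exists y.
have [|j def_j] := phiN y; first by rewrite inE; apply/existsP; exists x; rewrite adj_sym.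
rewrite def_i def_j /=; apply: contraTneq xy => ij.
by rewrite (phi_inj x y) ?adj_irrefl // def_i def_j ij.
Qed.

Section Upper.
Variables (G : sgraph) (n : nat).
Hypothesis Gn : #|G| = n.

Definition nbr (x : G) : {set G} := [set z | adj x z].

(** An edge [v y] with [v] placed at [x] leaves [degree x] places for [y]; the
other vertices are unconstrained. *)
Lemma card_edge_ext (v y : F) (x : G) : v != y ->
  #|inj_ext [set v] (fun _ => x) [set y] (nbr x) (~: [set x])|
    = degree x * (n - 2) ^_ (t - 2).
Proof.
move=> vy; rewrite card_inj_ext.
- have := cardsC1 x; have := cards1 x; rewrite Gn !cards1 => _ ->.
  rewrite ffactn1; congr (_ * _ ^_ _); lia.
- by move=> a b; rewrite !inE => /eqP-> /eqP->.
- by move=> a _; rewrite !inE eqxx.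
- by rewrite disjoints1 inE eq_sym.
- by apply/subsetP=> z; rewrite !inE; apply: contraTneq => ->; rewrite adj_irrefl.
Qed.

Lemma copy_edge_ext (v y : F) phi : adj v y -> phi \in copies G F ->
  phi \in inj_ext [set v] (fun _ => phi v) [set y] (nbr (phi v)) (~: [set phi v]).
Proof.
move=> vy /copiesP[phi_inj phiP]; apply/inj_extP; split=> // z.
rewrite !inE; case: (eqVneq z v) => [-> // | zv].
case: (eqVneq z y) => [-> | _]; first by rewrite inE phiP.
by rewrite !inE (inj_eq phi_inj).
Qed.

Lemma copies_le_edges (v y : F) : adj v y ->
  labeled_copies G F <= (\sum_(x : G) degree x) * (n - 2) ^_ (t - 2).
Proof.
move=> vy; have vNy : v != y by apply: contraTneq vy => ->; rewrite adj_irrefl.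
rewrite big_distrl /=.
under eq_bigr => x _ do rewrite -(card_edge_ext x vNy).
apply: leq_trans (card_bigcup_le _ _); apply/subset_leq_card/subsetP=> phi phiF.
by apply/bigcupP; exists (phi v) => //; apply: copy_edge_ext.
Qed.

(** A copy either keeps its non-isolated vertices off [R] or places some
non-isolated [v] at some [x] in [R], and then the chosen neighbour [nb v]
must go to one of the at most [k] neighbours of [x]. *)
Lemma copies_le_delete (R : {set G}) k : 0 < n -> (forall x, x \in R -> degree x <= k) ->
  labeled_copies G F <= (n - #|R|) ^_ #|N| * (n - #|N|) ^_ (t - #|N|)
     + #|R| * #|N| * k * (n - 2) ^_ (t - 2).
Proof.
move=> n_gt0 Rk.
have [g] := card_inj_into (~: R) Gn n_gt0.
have -> : #|~: R| = n - #|R| by rewrite cardsCs setCK Gn.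
move=> <-.
pose nb v : F := odflt v [pick y | adj v y].
have nbP v : v \in N -> adj v (nb v).
  by rewrite inE => /existsP[y vy]; rewrite /nb; case: pickP => //= /(_ y); rewrite vy.
pose E v x := inj_ext [set v] (fun _ => x) [set nb v] (nbr x) (~: [set x]).
have Ecard v x : v \in N -> x \in R -> #|E v x| <= k * (n - 2) ^_ (t - 2).
  move=> vN xR; rewrite card_edge_ext ?leq_mul2r ?Rk ?orbT //.
  by apply: contraTneq (nbP v vN) => <-; rewrite adj_irrefl.
apply: (@leq_trans #|inj_ext set0 g N (~: R) setT :|:
     \bigcup_(v in N) \bigcup_(x in R) E v x|).
  apply/subset_leq_card/subsetP=> phi phiF; rewrite inE.
  have [phi_inj _] := copiesP _ phiF.
  case: (pickP [pred v in N | phi v \in R]) => [v /andP[/= vN vR] | noR].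
    apply/orP; right; apply/bigcupP; exists v => //; apply/bigcupP; exists (phi v) => //.
    exact: copy_edge_ext (nbP v vN) phiF.
  apply/orP; left; apply/inj_extP; split=> // z; rewrite inE; case: ifP => zN; rewrite !inE //.
  by move: (noR z); rewrite /= zN /= => ->.
apply: leq_trans (leq_card_setU _ _) _; rewrite leq_add2l.
apply: leq_trans (card_bigcup_le _ _) _.
rewrite -mulnA -mulnA mulnCA -sum_nat_const.
apply: leq_sum => v vN; apply: leq_trans (card_bigcup_le _ _) _.
rewrite -sum_nat_const; apply: leq_sum => x xR; exact: Ecard.
Qed.

(** The edges inside the complement of [R] contribute at most the product.  The
number of edges that meet [R] is at most the sum of the degrees in [R], hence
at most [#|R| ^ 2], and each of them contributes 2. *)
Lemma sum_degree_le (R : {set G}) : (forall x, x \in R -> degree x <= #|R|) ->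
  \sum_(x : G) degree x <= 2 * #|R| ^ 2 + (n - #|R|) * (n - #|R|).-1.
Proof.
move=> Rk.
have degE (x : G) : degree x = \sum_(y : G) adj x y.
  by rewrite /degree -sum1dep_card big_mkcond; apply: eq_bigr => y _; case: (adj x y).
have RC : #|~: R| = n - #|R| by rewrite cardsCs setCK Gn.
have sumR : \sum_(x in R) degree x <= #|R| ^ 2.
  by rewrite -mulnn -sum_nat_const; apply: leq_sum.
rewrite (bigID (mem R)) /= mul2n -addnn -addnA; apply: leq_add => //.
under eq_bigr => x _ do rewrite degE (bigID (mem R)) /=.
rewrite big_split /=; apply: leq_add.
  rewrite exchange_big /=; apply: leq_trans sumR; apply: leq_sum => y _.
  rewrite degE [leqRHS](bigID (mem R)) /=.
  under eq_bigr => x _ do rewrite adj_sym.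
  exact: leq_addl.
rewrite -RC -sum_nat_const.
under eq_bigl => x do rewrite -in_setC.
apply: leq_sum => x xR.
rewrite (cardsD1 x) xR /= -sum1_card [leqRHS](eq_bigl (fun y => (y \notin R) && (y != x))).
  rewrite [leqRHS]big_mkcondr; apply: leq_sum => y _.
  by case: (eqVneq y x) => [->|]; rewrite ?adj_irrefl //; case: (adj x y).
by move=> y; rewrite !inE andbC.
Qed.

End Upper.

(** The three ranges of [k] need different arguments.  For [d < k < 2 d] one
deletes [d + 1] vertices; for [2 d <= k < n / 4] this may not gain enough,
as the loss grows with [k], and one deletes [2 d]; beyond [n / 4] the copies
meeting the deleted vertices are too many, but the edges of [G] too few. *)
Lemma many_low_bound (G : sgraph) n d k : #|G| = n ->
  4 * d * t + 3 * d ^ 2 + 5 * t <= n -> d < k -> k.*2 < n -> k <= #|low G k| ->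
  labeled_copies G F <= labeled_copies (H_graph n d) F.
Proof.
move=> Gn n_large dk kn k_low.
have n_gt0 : 0 < n by lia.
apply: leq_trans (H_copies_ge n_gt0 _); last by lia.
have Nt : #|N| <= t by rewrite -Ft max_card.
have [N0 | [v vN]] := set_0Vmem N.
  (* Without edges in [F], all injections are copies in both graphs. *)
  rewrite N0 cards0 ffactn0 mul1n !subn0.
  have [g] := card_inj_into [set: G] Gn n_gt0.
  rewrite N0 cards0 ffactn0 mul1n !subn0 => <-; apply/subset_leq_card/subsetP=> phi.
  by case/copiesP=> phi_inj _; apply/inj_extP; split=> // y; rewrite !inE.
have [y vy] : exists y, adj v y by move: vN; rewrite inE => /existsP.
have N_gt1 : 1 < #|N|.
  rewrite (cardsD1 v) vN ltnS; apply/card_gt0P; exists y; rewrite !inE.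
  rewrite (_ : y != v) /=; first by apply/existsP; exists v; rewrite adj_sym.
  by apply: contraTneq vy => ->; rewrite adj_irrefl.
have [s Ns] : exists s, #|N| = s.+2 by exists (#|N| - 2); lia.
have M_split : (n - 2) ^_ (t - 2) = (n - 2) ^_ s * (n - #|N|) ^_ (t - #|N|).
  have -> : t - 2 = s + (t - #|N|) by lia.
  by rewrite ffact_add; [congr (_ * _ ^_ _); lia | lia].
have sub_low r : r <= k -> exists2 R : {set G}, #|R| = r & forall x, x \in R -> degree x <= k.
  move=> rk; have [R /subsetP RL Rr] : exists2 R : {set G}, R \subset low G k & #|R| = r.
    exists [set x in take r (enum (low G k))].
      by apply/subsetP=> x; rewrite inE => /mem_take; rewrite mem_enum.
    rewrite cardsE (card_uniqP _) ?take_uniq ?enum_uniq // size_take -cardE.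
    by case: ltngtP (leq_trans rk k_low).
  by exists R => // x /RL; rewrite inE.
have delete r : d < r -> r <= k -> r * k <= (r - d) * (n.-1 - r.-1 * s.+1) ->
    labeled_copies G F <= (n - d) ^_ #|N| * (n - #|N|) ^_ (t - #|N|).
  move=> dr rk r_arith; have [R Rr Rk] := sub_low r rk.
  apply: leq_trans (copies_le_delete Gn n_gt0 Rk) _.
  rewrite Rr M_split mulnA -mulnDl leq_mul2r Ns; apply/orP; right.
  by apply: delete_arith => //; lia.
case: (leqP n (4 * k)) => k_large.
  have [R Rr Rk] := sub_low k (leqnn k).
  apply: leq_trans (copies_le_edges Gn vy) _.
  rewrite M_split mulnA leq_mul2r; apply/orP; right.
  have := @edge_arith n d k s; rewrite -Ns => ea.
  apply: leq_trans (ea _ _ _) => //; last by nia.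
  rewrite leq_mul2r -Rr; apply/orP; right; apply: sum_degree_le => //.
  by rewrite Rr.
case: (leqP d.*2 k) => dk2.
  case: (posnP d) => d0; first by apply: (delete 1); lia.
  apply: (delete d.*2) => //; first by lia.
  have -> : d.*2 - d = d by lia.
  suff : 2 * k <= n.-1 - d.*2.-1 * s.+1 by nia.
  have : d.*2.-1 * s.+1 <= 2 * d * t by nia.
  by lia.
apply: (delete d.+1) => //=.
have -> : d.+1 - d = 1 by lia.
rewrite mul1n.
have : d.+1 * k <= d.+1 * (2 * d) by rewrite leq_mul2l; lia.
have : d * s.+1 <= d * t by rewrite leq_mul2l; lia.
nia.
Qed.

End Bounds.

(** * Exactly d vertices of degree d *)

Section Hub.
Variables (G : sgraph) (D S' : {set G}).

(** When [D] and [S'] are disjoint sets of size [d], this is [H_graph] with [D]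
as the independent set, on the vertices of [G], so that copies in both graphs
can be compared as functions ([hub_copies_le]). *)
Definition hub_adj : rel G := fun u v =>
  (u != v) && [|| (u \notin D) && (v \notin D), (u \in D) && (v \in S')
                | (u \in S') && (v \in D)].

Lemma hub_adj_sym : symmetric hub_adj.
Proof.
move=> u v; rewrite /hub_adj eq_sym; congr (_ && _).
by rewrite andbC; congr (_ || _); rewrite orbC andbC [X in _ || X]andbC.
Qed.

Lemma hub_adj_irrefl : irreflexive hub_adj.
Proof. by move=> u; rewrite /hub_adj eqxx. Qed.

Definition hub_graph : sgraph := SGraph hub_adj_sym hub_adj_irrefl.

Lemma hub_copies_le (F : sgraph) n d :
  #|G| = n -> 0 < n -> #|D| = d -> S' \subset ~: D -> #|S'| = d ->
  labeled_copies hub_graph F <= labeled_copies (H_graph n d) F.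
Proof.
move=> Gn n_gt0 Dd S'D S'd.
have dn : d <= n by rewrite -Gn -Dd max_card.
have [v0 _] : exists v0 : G, true by move: n_gt0; rewrite -Gn => /card_gt0P[v0 _]; exists v0.
(* The first [d] clique vertices of [H_graph n d] are its hubs, hence the
   elements of [S'] come first. *)
pose sK := enum S' ++ enum (~: D :\: S').
have memK u : (u \in sK) = (u \notin D).
  rewrite mem_cat !mem_enum !inE; case uS: (u \in S') => //=.
  by have := subsetP S'D u uS; rewrite inE.
have sizeK : size sK = n - d.
  rewrite size_cat -!cardE cardsD (setIidPr S'D) subnKC ?subset_leq_card //.
  by rewrite cardsCs setCK Gn Dd.
have uniqK : uniq sK.
  rewrite cat_uniq !enum_uniq andbT /=; apply/hasPn=> u.
  by rewrite !mem_enum inE => /andP[].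
pose f (a : H_graph n d) : hub_graph :=
  match a with inl i => nth v0 sK i | inr j => nth v0 (enum D) j end.
have fK i : f (inl i) \notin D by rewrite -memK mem_nth // sizeK.
have fD j : f (inr j) \in D by rewrite -mem_enum mem_nth // -cardE Dd.
have f_inj : injective f.
  move=> [i|i] [j|j] /= eq_f.
  - congr inl; apply/val_inj/eqP; rewrite /= -(nth_uniq v0 _ _ uniqK) ?sizeK //.
    exact/eqP.
  - by have := fK i; rewrite [f _]eq_f fD.
  - by have := fK j; rewrite -[f _]eq_f fD.
  - congr inr; apply/val_inj/eqP.
    by rewrite /= -(nth_uniq v0 _ _ (enum_uniq (mem D))) -?cardE ?Dd //; apply/eqP.
have [g fgK gfK] : bijective f.
  apply: inj_card_bij => //; rewrite card_sum !card_ord.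
  by rewrite [X in X <= _]Gn; lia.
apply: (@labeled_copies_hom _ _ _ g); first exact: can_inj gfK.
move=> u v; rewrite -{1}(gfK u) -{1}(gfK v).
have S'low i : f (inl i) \in S' -> i < d.
  move=> fiS; rewrite ltnNge; apply: contraL fiS => di.
  have : f (inl i) \in ~: D :\: S'.
    rewrite /= nth_cat -cardE S'd ltnNge di /= -mem_enum mem_nth //.
    by move: sizeK (ltn_ord i); rewrite size_cat -!cardE S'd => sizeK /=; lia.
  by rewrite inE => /andP[].
have S'ND j : f (inr j) \notin S' by apply: contraL (fD j) => /(subsetP S'D); rewrite inE.
case: (g u) => [i|i]; case: (g v) => [j|j]; rewrite /= /hub_adj => /andP[].
- by move=> fij _; apply: contraNneq fij => ->.
- rewrite (negPf (fK i)) fD (negPf (S'ND j)) /= andbT => _; exact: S'low.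
- rewrite (negPf (fK j)) fD (negPf (S'ND i)) /= orbF => _; exact: S'low.
- by rewrite !fD (negPf (S'ND i)) (negPf (S'ND j)).
Qed.

End Hub.

Section Exact.
Variables (F G : sgraph) (t n d : nat) (D S S' : {set G}).
Hypotheses (Ft : #|F| = t) (Gn : #|G| = n) (d_gt0 : 0 < d) (n_large : 2 * (d * t) <= n - t).
Hypotheses (Dd : #|D| = d) (degD : forall x, x \in D -> degree x = d).
Hypotheses (S'D : S' \subset ~: D) (S'd : #|S'| = d) (SS' : S \subset S').
Hypothesis adjS : forall x u, x \in D -> u \notin D -> adj x u = (u \in S).

Let SD : S \subset ~: D := subset_trans SS' S'D.

(** Injections with [v] placed at [x], the neighbours of [v] at neighbours of
[x] but not all of them in [S], and no other constraint: for [x] in [D] this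
includes the copies in [G] that place some neighbour of [v] in [D]. *)
Let lost (v : F) (x : G) :=
  inj_ext [set v] (fun _ => x) (nbr v) (nbr x) (~: [set x])
    :\: inj_ext [set v] (fun _ => x) (nbr v) S (~: [set x]).

(** For [x] in [D], copies in the hub graph only: [v] alone is in [D], with a
neighbour in [S' :\: S]. *)
Let gained (v : F) (x : G) :=
  inj_ext [set v] (fun _ => x) (nbr v) S' (~: D)
    :\: inj_ext [set v] (fun _ => x) (nbr v) S (~: D).

Lemma S_nbr x : x \in D -> S \subset nbr x.
Proof.
move=> xD; apply/subsetP=> u uS; rewrite inE adjS //.
by have := subsetP SD u uS; rewrite inE.
Qed.

Lemma card_star_ext (v : F) (x : G) (U W : {set G}) : x \notin W -> U \subset W ->
  #|inj_ext [set v] (fun _ => x) (nbr v) U W|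
    = #|U| ^_ degree v * (#|W| - degree v) ^_ (t.-1 - degree v).
Proof.
move=> xW UW; rewrite card_inj_ext //.
- by rewrite cards1 Ft subn1.
- by move=> a b; rewrite !inE => /eqP-> /eqP->.
- by rewrite disjoint_sym disjoints1 inE adj_irrefl.
Qed.

(** With [a] the degree of [v], both counts contain the factor
[d ^_ a - #|S| ^_ a], since [x] has as many neighbours in [G] as [S'] has
elements; only the placements of the remaining vertices differ. *)
Lemma lost_le_gained v x : x \in D -> #|lost v x| <= 2 * #|gained v x|.
Proof.
move=> xD; rewrite !cardsD.
have xDC : x \notin ~: D by rewrite inE xD.
have xx : x \notin ~: [set x] by rewrite !inE eqxx.
have nx : nbr x \subset ~: [set x].
  by apply/subsetP=> u; rewrite !inE; apply: contraTneq => ->; rewrite adj_irrefl.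
rewrite (setIidPr (inj_ext_subset _ _ _ _ (S_nbr xD))).
rewrite (setIidPr (inj_ext_subset _ _ _ _ SS')).
rewrite !card_star_ext //; last exact: subset_trans (S_nbr xD) nx.
have -> : #|nbr x| = d by rewrite -(degD xD).
have -> : #|~: D| = n - d by rewrite cardsCs setCK Gn Dd.
have -> : #|~: [set x]| = n.-1 by rewrite cardsC1 Gn.
rewrite S'd -!mulnBl mulnCA leq_mul2l ffact_le_double ?orbT //.
rewrite -Ft; apply: leq_trans (_ : #|v |: nbr v| <= _); last exact: max_card.
by rewrite cardsU1 inE adj_irrefl.
Qed.

(** The two graphs disagree on a pair that is adjacent in [G] only if both
vertices are in [D]; either end of such an edge of [F] can serve as [v]. *)
Lemma copies_lost phi : phi \in copies G F -> phi \notin copies (hub_graph D S') F ->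
  exists v1 v2 : F, [/\ v1 != v2, phi v1 \in D, phi v2 \in D,
     phi \in lost v1 (phi v1) & phi \in lost v2 (phi v2)].
Proof.
move=> /copiesP[phi_inj phi_hom]; rewrite inE negb_and.
have /injectiveP -> /= := phi_inj.
rewrite negb_forall => /existsP[v1]; rewrite negb_forall => /existsP[v2].
rewrite negb_imply => /andP[v12]; rewrite /hub_adj.
have vN : v1 != v2 by apply: contraTneq v12 => ->; rewrite adj_irrefl.
have := phi_hom _ _ v12; rewrite (inj_eq phi_inj) vN /= !negb_or => a12.
case D1: (phi v1 \in D); case D2: (phi v2 \in D) => //=; first last.
- by rewrite andbT; move: a12; rewrite adj_sym adjS ?D1 // => /(subsetP SS') ->.
- by rewrite ?andbF ?orbF; move: a12; rewrite adjS ?D2 // => /(subsetP SS') ->.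
move=> _; have in_lost u w : adj u w -> phi u \in D -> phi w \in D -> phi \in lost u (phi u).
  move=> uw uD wD; rewrite inE; apply/andP; split.
    apply/negP=> /inj_extP[_ /(_ w)]; rewrite !inE uw.
    case: eqVneq uw => [->|_ _]; first by rewrite adj_irrefl.
    by move/(subsetP SD); rewrite inE wD.
  apply/inj_extP; split=> // z; rewrite !inE.
  case: (eqVneq z u) => [-> // | zu]; case: ifP => uz; rewrite !inE ?phi_hom //.
  by rewrite (inj_eq phi_inj).
by exists v1, v2; split=> //; [apply: in_lost v12 _ _ | apply: (in_lost _ v1); rewrite // adj_sym].
Qed.

Lemma gained_copies v x phi : x \in D -> phi \in gained v x ->
  [/\ phi \in copies (hub_graph D S') F, phi \notin copies G F, phi v = x
    & forall z, z != v -> phi z \notin D].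
Proof.
move=> xD; rewrite inE => /andP[NphiS /inj_extP[phi_inj phiP]].
have phiv : phi v = x by have := phiP v; rewrite inE eqxx.
have phiD z : z != v -> phi z \notin D.
  move=> zv; have := phiP z; rewrite inE (negPf zv).
  by case: ifP => _; [move/(subsetP S'D) | ]; rewrite inE.
have phiS' z : adj v z -> phi z \in S'.
  move=> vz; have := phiP z; rewrite !inE vz; case: eqVneq vz => [-> | //].
  by rewrite adj_irrefl.
split=> //.
  apply/copiesP; split=> // a b ab.
  have aNb : a != b by apply: contraTneq ab => ->; rewrite adj_irrefl.
  rewrite /= /hub_adj (inj_eq phi_inj) aNb /=.
  case: (eqVneq a v) ab aNb => [-> | av] ab; first by rewrite phiv xD phiS' // orbT.
  case: (eqVneq b v) ab => [-> | bv] ab _; last by rewrite !phiD.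
  by rewrite phiv xD phiS' ?orbT // adj_sym.
apply: contra NphiS => /copiesP[_ phi_hom]; apply/inj_extP; split=> // z.
have := phiP z; rewrite !inE; case: (eqVneq z v) => // zv; case: ifP => // vz _.
by rewrite -(@adjS x) ?phiD // -phiv phi_hom.
Qed.

(** Each lost copy lies in at least two of the sets [lost v x], whereas the sets
[gained v x] are disjoint: this pays for the factor 2 in [lost_le_gained]. *)
Lemma copies_le_hub : labeled_copies G F <= labeled_copies (hub_graph D S') F.
Proof.
rewrite !labeled_copiesE -(cardsID (copies (hub_graph D S') F) (copies G F)).
rewrite -[leqRHS](cardsID (copies G F)) [copies G F :&: _]setIC leq_add2l.
pose E1 (p : F * G) := if p.2 \in D then lost p.1 p.2 else set0.
pose E2 (p : F * G) := if p.2 \in D then gained p.1 p.2 else set0.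
have lost_sum : 2 * #|copies G F :\: copies (hub_graph D S') F| <= \sum_p #|E1 p|.
  rewrite double_count mulnC -sum_nat_const big_mkcond /=; apply: leq_sum => phi _.
  case: ifP => //; rewrite inE => /andP[phiH phiG].
  have [v1 [v2 [v12 v1D v2D v1_lost v2_lost]]] := copies_lost phiG phiH.
  have <- : #|[set (v1, phi v1); (v2, phi v2)]| = 2 by rewrite cards2 xpair_eqE (negPf v12).
  apply/subset_leq_card/subsetP=> p; rewrite !inE => /orP[]/eqP->.
    by rewrite /E1 /= v1D.
  by rewrite /E1 /= v2D.
have gained_sum : \sum_p #|E2 p| <= #|copies (hub_graph D S') F :\: copies G F|.
  rewrite double_count -sum1_card [leqRHS]big_mkcond /=; apply: leq_sum => phi _.
  have E2P p : p \in [set p | phi \in E2 p] -> p.2 \in D /\ phi \in gained p.1 p.2.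
    by rewrite inE /E2; case: ifP; rewrite ?inE.
  case: (set_0Vmem [set p | phi \in E2 p]) => [-> | [p pE2]]; first by rewrite cards0.
  have [pD p_gained] := E2P p pE2; have [phiH phiG phi_p phiND] := gained_copies pD p_gained.
  rewrite inE phiH phiG; apply/card_le1_eqP=> q1 q2.
  have same q : q \in [set p | phi \in E2 p] -> q = p.
    move=> /E2P[qD q_gained]; have [_ _ phi_q _] := gained_copies qD q_gained.
    have q1E : q.1 = p.1.
      by apply/eqP; apply: contraTT qD => /phiND; rewrite phi_q.
    by rewrite [q]surjective_pairing [p]surjective_pairing -phi_q -phi_p q1E.
  by move=> /same-> /same->.
rewrite -(leq_pmul2l (isT : 0 < 2)); apply: leq_trans lost_sum _.
apply: leq_trans (leq_mul (leqnn 2) gained_sum); rewrite big_distrr /=.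
apply: leq_sum => -[v x] _; rewrite /E1 /E2 /=.
by case: ifP => [xD | _]; [apply: lost_le_gained | rewrite cards0].
Qed.

End Exact.

(** * Comparison with the extremal graph *)

Section Comparison.
Variables (F : sgraph) (t d n : nat).
Hypotheses (Ft : #|F| = t) (d_gt0 : 0 < d) (n_large : n0 d t <= n) (t_ge3 : 2 < t).

(** If more than [d] vertices have degree [d], then [many_low_bound] applies
with [k] equal to [d + 1]. *)
Lemma ore_closed_bound (G : sgraph) :
  #|G| = n -> ore_closed G -> nonhamiltonian G -> (forall x : G, d <= degree x) ->
  labeled_copies G F <= labeled_copies (H_graph n d) F.
Proof.
move=> Gn G_ore G_nonham deg_d; move: (n_large); rewrite /n0 => n_ge.
have n_gt_dt : 4 * (d * t) + 5 * t <= n by lia.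
have dt : d <= d * t by rewrite leq_pmulr //; lia.
have bound := many_low_bound Ft Gn n_ge.
case: (leqP #|low G d| d) => [D_le | D_gt]; last first.
  apply: (bound d.+1) => //; first by lia.
  by apply: leq_trans D_gt _; apply/subset_leq_card/subsetP=> x; rewrite !inE => /leqW.
case: (pickP [pred p : G * G | [&& p.1 != p.2, ~~ adj p.1 p.2, d < degree p.1 & d < degree p.2]])
    => [[u v] /and4P[/= uv Nuv du dv] | noP].
  by have [k [dk kn k_low]] := many_low G_ore uv Nuv du dv; apply: (bound k); rewrite // -Gn.
have D_clique u v : u \notin low G d -> v \notin low G d -> u != v -> adj u v.
  rewrite !inE -!ltnNge => du dv uv; move: (noP (u, v)).
  by rewrite /= uv du dv !andbT => /negbFE.
have [||Dd [S [SD S_le adjS]]] := few_low Gn G_ore G_nonham _ _ deg_d D_le D_clique; try lia.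
have degD x : x \in low G d -> degree x = d.
  by rewrite inE => x_le; apply/eqP; rewrite eqn_leq x_le deg_d.
have DC := card_setC (low G d) Gn.
have [|S' [SS' S'D S'd]] := exists_intermediate_set SD S_le; first by lia.
apply: leq_trans (hub_copies_le F Gn _ Dd S'D S'd); last by lia.
by apply: copies_le_hub Ft Gn d_gt0 _ Dd degD S'D S'd SS' adjS; lia.
Qed.

(** By induction on the number of nonadjacent pairs, adding edges until the
graph is Ore-closed. *)
Lemma nonhamiltonian_bound (G : sgraph) :
  #|G| = n -> nonhamiltonian G -> (forall x : G, d <= degree x) ->
  labeled_copies G F <= labeled_copies (H_graph n d) F.
Proof.
have [m] := ubnP #|[set p : G * G | ~~ adj p.1 p.2]|.
elim: m => // m IHm in G * => non_edges Gn G_nonham deg_d.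
case: (pickP [pred p : G * G | [&& p.1 != p.2, ~~ adj p.1 p.2 & n <= degree p.1 + degree p.2]])
    => [[x y] /and3P[/= xy Nxy deg_xy] | noP]; last first.
  apply: ore_closed_bound => // x y xy Nxy; rewrite Gn ltnNge; apply/negP=> deg_xy.
  by move: (noP (x, y)); rewrite /= xy Nxy deg_xy.
apply: (@leq_trans (labeled_copies (add_edge x y) F)).
  by apply: (@labeled_copies_hom G (add_edge x y) F (fun u => u)) => [u v //|u v uv]; rewrite /= /add_edge_adj uv.
apply: IHm => //.
- rewrite -ltnS; apply: leq_trans non_edges; rewrite ltnS; apply/proper_card/properP; split.
    by apply/subsetP=> p; rewrite !inE negb_or => /andP[].
  by exists (x, y); rewrite !inE //= /add_edge_adj xy !eqxx orbT.
- by case=> c c_ham; apply: G_nonham; apply: add_edge_ham c_ham _; rewrite Gn.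
move=> z; apply: leq_trans (deg_d z) _; apply/subset_leq_card/subsetP=> u.
by rewrite !inE /= /add_edge_adj => ->.
Qed.

End Comparison.

Theorem theorem4 (F : sgraph) (t d n : nat) (G : sgraph) :
  #|F| = t -> 3 <= t -> 1 <= d -> n0 d t <= n ->
  #|G| = n -> nonhamiltonian G -> d <= min_degree G ->
  labeled_copies G F <= labeled_copies (H_graph n d) F.
Proof.
move=> Ft t_ge3 d_gt0 n_large Gn G_nonham deg_d.
apply: (nonhamiltonian_bound Ft) => // x.
exact: leq_trans deg_d (min_degree_le x).
Qed.
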